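(* There exists a map $e:\mathscr P_{\omega_1}(\omega_1)\to\boldsymbol\beta\omega$ such that for all $X,Y\in\mathscr P_{\omega_1}(\omega_1)$: (i) if $X\subseteq Y$ then $e(X)\le_{\mathrm{RK}}e(Y)$; (ii) if $e(X)\le_{\mathrm C}e(Y)$ then $X\subseteq Y$. Consequently, for every binary relation $R$ on $\boldsymbol\beta\omega$ with ${\le_{\mathrm{RK}}}\subseteq R\subseteq{\le_{\mathrm C}}$, the map $e$ is an isomorphic embedding of the lattice $(\mathscr P_{\omega_1}(\omega_1),\subseteq)$ into the structure $(\boldsymbol\beta\omega,R)$, i.e., $e$ is injective and $X\subseteq Y$ iff $e(X)\,R\,e(Y)$.
   Context: $\boldsymbol\beta\omega$ is the set of all ultrafilters over $\omega$ (principal ones included; $n\in\omega$ is identified with the principal ultrafilter at $n$), with the topology generated by the sets $\{\mathfrak u:A\in\mathfrak u\}$, $A\subseteq\omega$; it is the Čech–Stone compactification of discrete $\omega$. For a map $f$ of $\omega$ into a compact Hausdorff space $K$, $\widetilde f:\boldsymbol\beta\omega\to K$ is its unique continuous extension. $\mathscr P_{\omega_1}(\omega_1)$ is the set of at most countable subsets of $\omega_1$. Rudin–Keisler preorder: $\mathfrak u\le_{\mathrm{RK}}\mathfrak v$ iff there is $f:\omega\to\omega$ with $\widetilde f(\mathfrak v)=\mathfrak u$. Comfort preorder: a Tychonoff space $X$ is $\mathfrak u$-compact iff for every $f:\omega\to X$ one has $\widetilde f(\mathfrak u)\in X$, where $\widetilde f:\boldsymbol\beta\omega\to\boldsymbol\beta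 X$ and $\boldsymbol\beta X\supseteq X$ is the Čech–Stone compactification of $X$; $\mathfrak u\le_{\mathrm C}\mathfrak v$ iff every $\mathfrak v$-compact (Tychonoff) space is $\mathfrak u$-compact. One has ${\le_{\mathrm{RK}}}\subseteq{\le_{\mathrm C}}$. *)

(* Defs.v *)
(* MathComp / MathComp-Analysis. *)
From HB Require Import structures.
From mathcomp Require Import all_boot all_order all_algebra.
From mathcomp Require Import finmap wochoice.
From mathcomp Require Import all_classical all_reals all_analysis.

Set Implicit Arguments.
Unset Strict Implicit.
Unset Printing Implicit Defensive.

Import Order.TTheory GRing.Theory Num.Theory.
Import numFieldNormedType.Exports.

Local Open Scope classical_set_scope.
Local Open Scope ring_scope.

Definition beta_omega : Type := {u : set_system nat | UltraFilter u}.

HB.instance Definition _ := gen_eqMixin beta_omega.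
HB.instance Definition _ := gen_choiceMixin beta_omega.
HB.instance Definition _ := @isSubBaseTopological.Build beta_omega
  (set nat) [set: set nat] (fun A => [set u : beta_omega | sval u A]).

Definition principal (n : nat) : beta_omega :=
  exist _ (principal_filter n) (principal_filter_ultra n).

Lemma beta_nbhsP (u : beta_omega) (N : set beta_omega) :
  nbhs u N <-> exists2 A, sval u A & [set v : beta_omega | sval v A] `<=` N.
Proof.
split.
- move=> [B [[D' sD' DB] Bu BN]].
  move: Bu; rewrite -DB => -[I D'I Iu].
  have {}Iu : (I : set beta_omega) u by exact: Iu.
  have {sD'} [E EI] : exists E : {fset (set nat)},
      \bigcap_(A in [set` E]) [set u : beta_omega | sval u A] = I.
    by have [E _ EI] := sD' _ D'I; exists E.
  exists (\bigcap_(A in [set` E]) A).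
    case: (svalP u) => uf _.
    apply: filter_bigI => A AE.
    by move: Iu; rewrite -EI; apply.
  move=> v vA.
  apply: BN.
  rewrite -DB.
  exists I => //.
  suff : (I : set beta_omega) v by [].
  rewrite -EI => A AE /=.
  case: (svalP v) => vf _.
  apply: filterS vA => n; exact.
- move=> [A uA AN].
  exists [set v : beta_omega | sval v A]; split => //.
  exists [set [set v : beta_omega | sval v A]]; last by rewrite bigcup_set1.
  move=> _ ->.
  exact: (@finI_from1 _ _ setT
    (fun A : set nat => [set u0 : beta_omega | sval u0 A])).
Qed.

Lemma ultra_fmap T U (f : T -> U) (F : set_system T) :
  UltraFilter F -> UltraFilter (f @ F).
Proof.
move=> FU; split; first exact: fmap_proper_filter.
move=> G GF FG.
rewrite eqEsubset; split=> // A GA.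
have [//|nA] := in_ultra_setVsetC (f @^-1` A) FU.
have /(filterI GA) : G (~` A) by apply: FG.
by rewrite setICr => /filter_not_empty.
Qed.

Lemma beta_hausdorff : hausdorff_space beta_omega.
Proof.
move=> u v uv.
have P A : sval u A -> sval v A.
  move=> uA.
  have [//|vA] := in_ultra_setVsetC A (svalP v).
  have nu : nbhs u [set w : beta_omega | sval w A] by apply/beta_nbhsP; exists
    A.
  have nv : nbhs v [set w : beta_omega | sval w (~` A)] by apply/beta_nbhsP;
    exists (~` A).
  have [w [/= wA wA']] := uv _ _ nu nv.
  case: (svalP w) => wf _.
  have : sval w set0 by rewrite -(setICr A); apply: filterI.
  by move/filter_not_empty.
apply/eq_sig_hprop => [?|]; first exact: Prop_irrelevance.
case: (svalP u) => uf um.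
case: (svalP v) => vf _.
by rewrite (um (sval v)).
Qed.

Lemma beta_compact : compact [set: beta_omega].
Proof.
rewrite compact_ultra => F FU _.
have FF := ultra_proper (UltraFilter := FU).
pose G : set_system nat := [set A | F [set w : beta_omega | sval w A]].
have GU : UltraFilter G.
  split.
    apply: Build_ProperFilter_ex.
      move=> A GA; have [w wA] := @filter_ex _ F _ _ GA.
      case: (svalP w) => wf _.
      exact: filter_ex wA.
    split; first by rewrite /G /=; apply: (@filterS _ F _ setT) filterT => w _
      /=; case: (svalP w) => wf _; exact: filterT.
      move=> A B; rewrite /G /= => FA FB.
      apply: filterS (filterI FA FB) => w [/= wA wB].
      by case: (svalP w) => wf _; exact: filterI.
    move=> A B AB; rewrite /G /=; apply: filterS => w /= wA.
    case: (svalP w) => wf _; exact: filterS wA.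
  move=> H HF GH.
  rewrite eqEsubset; split=> // A HA.
  have [//|nA] := in_ultra_setVsetC [set w : beta_omega | sval w A] FU.
  have /(filterI HA) : H (~` A).
    apply: GH; apply: filterS nA => w /= wA.
    by have [//|] := in_ultra_setVsetC A (svalP w).
  by rewrite setICr => /filter_not_empty.
exists (exist _ G GU); split=> //= N /beta_nbhsP[A /= GA AN].
exact: filterS AN GA.
Qed.

(* For K compact Hausdorff, such a g exists and is unique. *)
Definition is_beta_extension (K : topologicalType)
    (f : nat -> K) (g : beta_omega -> K) : Prop :=
  continuous g /\ forall n, g (principal n) = f n.

Lemma beta_extension_exists (K : topologicalType) (f : nat -> K) :
  hausdorff_space K -> compact [set: K] -> exists g, is_beta_extension f g.
Proof.
move=> hK cK.
have /choice[g gP] : forall u : beta_omega, exists x : K, f @ sval u --> x.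
  move=> u.
  case: (svalP u) => uf um.
  have := cK; rewrite compact_ultra => /(_ (f @ sval u)).
  case; first by apply: ultra_fmap; exact: (svalP u).
    exact: filterT.
  by move=> x [_ xP]; exists x.
exists g; split.
- move=> u N /= gN.
  have [M [gM MN]] : exists M, nbhs (g u) M /\ closure M `<=` N.
    have [] := @compact_regular _ (g u) setT hK cK (filterT) N gN.
    by move=> M gM clM; exists M.
  have uM : sval u (f @^-1` M) by exact: (gP u).
  apply/beta_nbhsP; exists (f @^-1` M) => // v vM.
  apply: MN.
  move=> O gO.
  case: (svalP v) => vf _.
  have vO : sval v (f @^-1` O) by exact: (gP v).
  have [n [Mn On]] := filter_ex (filterI vM vO).
  by exists (f n).
- move=> n.
  have pf := ultra_proper (UltraFilter := principal_filter_ultra n).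
  apply: (@cvg_unique _ hK (f @ principal_filter n)); first by exact: (gP
    (principal n)).
  move=> A /nbhs_singleton fA.
  exact/principal_filterP.
Qed.

Lemma beta_extension_unique (K : topologicalType) (f : nat -> K) g1 g2 :
  hausdorff_space K -> is_beta_extension f g1 -> is_beta_extension f g2 ->
  g1 = g2.
Proof.
move=> hK [c1 e1] [c2 e2]; apply/funext => u.
apply: hK => A B nA nB.
have /beta_nbhsP[C uC CA] := c1 u _ nA.
have /beta_nbhsP[D uD DB] := c2 u _ nB.
case: (svalP u) => uf _.
have [n [Cn Dn]] := filter_ex (filterI uC uD).
exists (f n); split.
  by rewrite -e1; apply: CA => /=; exact/principal_filterP.
by rewrite -e2; apply: DB => /=; exact/principal_filterP.
Qed.

Definition RK_le (u v : beta_omega) : Prop :=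
  exists (f : nat -> nat) (g : beta_omega -> beta_omega),
    is_beta_extension (principal \o f) g /\ g v = u.

(* The Stone-Cech compactification of X is the closure of the canonical image
   of X in the power of the unit interval indexed by all continuous maps from X
   to the unit interval.  The closure is taken in the corresponding power of R,
   in which the power of the unit interval is closed. *)
Section StoneCech.
Variables (R : realType) (X : topologicalType).

Definition unit_map : Type :=
  {h : X -> R | continuous h /\ range h `<=` `[0, 1]}.

Definition cube_eval (x : X) : {ptws unit_map -> R} := fun h => sval h x.

Definition stone_cech : Type := set_type (closure (range cube_eval)).

HB.instance Definition _ :=
  Topological.copy stone_cech (set_type (closure (range cube_eval))).

Lemma cube_evalP (x : X) : cube_eval x \in closure (range cube_eval).
Proof. by apply/mem_set/subset_closure; exists x. Qed.

Definition stone_cech_embed (x : X) : stone_cech :=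
  exist (fun z => z \in closure (range cube_eval)) (cube_eval x) (cube_evalP x).

End StoneCech.

Lemma ev_continuous (U : Type) (T : topologicalType) (h : U) :
  continuous (fun f : {ptws U -> T} => f h).
Proof. exact: (@proj_continuous {classic U} (fun=> T) h). Qed.

Lemma stone_cech_val_continuous (R : realType) (X : topologicalType) :
  continuous (sval : stone_cech R X -> {ptws unit_map R X -> R}).
Proof. by move=> z; exact: initial_continuous. Qed.

Lemma stone_cech_hausdorff (R : realType) (X : topologicalType) :
  hausdorff_space (stone_cech R X).
Proof.
move=> x y xy.
apply/val_inj.
apply/functional_extensionality_dep => h.
apply: (@Rhausdorff R) => A B nA nB.
have cv z : {for z, continuous (fun z : stone_cech R X => (sval z : {ptws
  unit_map R X -> R}) h)}.
  apply: (@continuous_comp (stone_cech R X) ({ptws unit_map R X -> R}) R (fun z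
    => sval z) (fun f => f h)).
    exact: stone_cech_val_continuous.
  exact: ev_continuous.
have [z [zA zB]] := xy _ _ (cv x _ nA) (cv y _ nB).
by eexists; split; [exact: zA|exact: zB].
Qed.

Lemma stone_cech_compact (R : realType) (X : topologicalType) :
  compact [set: stone_cech R X].
Proof.
have tych : compact [set f : {ptws unit_map R X -> R} | forall h,
  `[0,1]%classic (f h)].
  exact: (@function_spaces.tychonoff {classic (unit_map R X)} (fun=> R) (fun=>
    `[0, 1]%classic) (fun=> @segment_compact R 0 1)).
rewrite compact_ultra => F FU _.
have FF := ultra_proper (UltraFilter := FU).
have cl : closed [set f : {ptws unit_map R X -> R} | forall h, `[0,1]%classic
  (f h)].
  rewrite (_ : [set _ | _] = \bigcap_h ((fun f : {ptws unit_map R X -> R} => f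
    h) @^-1` `[0,1]%classic)); last first.
    by apply/seteqP; split => f /=; [move=> H h _; exact: H| move=> H h; exact:
      H].
  apply: closed_bigI => h _.
  apply: preimage_closed; last exact: itv_closed.
  move=> x _; exact: ev_continuous.
have sub : closure (range (@cube_eval R X)) `<=` [set f : {ptws unit_map R X ->
  R} | forall h, `[0,1]%classic (f h)].
  rewrite [X in _ `<=` X](closure_id _).1 //; apply: closureS => _ [x _ <-] h;
    apply: (svalP h).2.
  by exists x.
have Fcl : (sval @ F) (closure (range (@cube_eval R X))).
  apply: (@filterS _ F _ setT) filterT => z _ /=.
  exact/set_mem/(svalP z).
have := tych; rewrite compact_ultra => /(_ (sval @ F)).
case; first exact: ultra_fmap.
  by have FF' := ultra_proper (UltraFilter := ultra_fmap sval FU); apply: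
    filterS Fcl.
move=> f [_ Ff].
have fcl : f \in closure (range (@cube_eval R X)).
  apply/mem_set.
  have FF' := ultra_proper (UltraFilter := ultra_fmap sval FU).
  rewrite (closure_id (closure _)).1; last exact: closed_closure.
  move=> B nB.
  exact: filter_ex (filterI Fcl (Ff _ nB)).
exists (exist _ f fcl : stone_cech R X); split => //.
move=> N /= [_ [[W oW <-] /= Wf WN]].
apply: (filterS WN).
apply: Ff.
exact: open_nbhs_nbhs.
Qed.

Lemma stone_cech_dense (R : realType) (X : topologicalType) :
  closure (range (@stone_cech_embed R X)) = setT.
Proof.
apply/seteqP; split=> // z _ N [_ [[W oW <-] /= Wf WN]].
have [_ [[x _ <-] Wx]] := set_mem (svalP z) W (open_nbhs_nbhs (conj oW Wf)).
exists (stone_cech_embed R x); split; [by exists x|exact: WN].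
Qed.

Lemma stone_cech_embed_continuous (R : realType) (X : topologicalType) :
  continuous (@stone_cech_embed R X).
Proof.
move=> x N [_ [[W oW <-] /= Wf WN]].
apply: (filterS WN).
have cc : continuous (@cube_eval R X).
  move=> y; apply/cvg_sup => h U [_ [[V oV <-] /= Vy VU]].
  apply: (filterS VU).
  exact: ((svalP h).1 y) (open_nbhs_nbhs (conj oV Vy)).
exact: (cc x) (open_nbhs_nbhs (conj oW Wf)).
Qed.

Definition tychonoff_space (X : topologicalType) : Prop :=
  hausdorff_space X /\ completely_regular_space X.

Definition ultra_compact (R : realType) (u : beta_omega) (X : topologicalType)
    : Prop :=
  forall f : nat -> X, exists g : beta_omega -> stone_cech R X,
    is_beta_extension (@stone_cech_embed R X \o f) g /\
    range (@stone_cech_embed R X) (g u).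

Definition comfort_le (R : realType) (u v : beta_omega) : Prop :=
  forall X : topologicalType, tychonoff_space X ->
    ultra_compact R v X -> ultra_compact R u X.

(* (W, le) has order type omega_1: it is an uncountable well-order all of whose
   initial segments are countable. *)
Definition is_omega1 (W : Type) (le : rel W) : Prop :=
  [/\ well_order le,
      ~ countable [set: W]
    & forall a : W, countable [set b | le b a]].

Lemma omega1_exists : exists (W : Type) (le : rel W), is_omega1 le.
Proof.
have [le wole] := well_ordering_principle (nat -> bool).
have unc : ~ countable [set: nat -> bool].
  move/countable_injP => [f].
  move=> finj.
  pose g : nat -> bool := fun n => ~~ `[< exists2 a : nat -> bool, f a = n & a
    n >].
  have [ga|/negP ga] := boolP (g (f g)).
    have : ~~ `[< exists2 a : nat -> bool, f a = f g & a (f g) >] by [].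
    by move/asboolP; apply; exists g.
  apply: ga.
  apply/asboolP => -[a fa aa].
  have ag : a = g by apply: finj; rewrite ?inE.
  move: (aa); rewrite ag => gfg; move/asboolP: (gfg); apply; by exists g.
have [H|/existsNP[a0 na0]] := pselect (forall a : nat -> bool, countable [set b
  | le b a]).
  by exists (nat -> bool); exists le; split.
have [a [[aA amin] _]] := wole [pred a | `[< ~ countable [set b | le b a] >]]
  (ex_intro _ a0 (asboolT na0)).
have na := asboolW aA.
have lexx x : le x x.
  have [z [[/eqP-> zm] _]] := wole (pred1 x) (ex_intro _ x (eqxx x)).
  by apply: zm; exact: eqxx.
have leanti x y : le x y -> le y x -> x = y.
  move=> xy yx.
  have [z [_ zu]] := wole (pred2 x y) (ex_intro _ x (predU1l _ erefl)).
  rewrite -(zu x); last first.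
    by split; [exact: predU1l|move=> w /orP[] /eqP ->].
  by apply: zu; split; [exact: predU1r (eqxx _)|move=> w /orP[] /eqP ->].
pose V := {b : nat -> bool | le b a && (b != a)}.
exists (V : Type); exists (fun x y => le (val x) (val y)); split.
- move=> A [x Ax].
  pose B : {pred nat -> bool} := fun b => `[< exists2 y : V, y \in A & val y =
    b >].
  have Bx : val x \in B by apply/asboolP; exists x.
  have [z [[/asboolP[y yA yz] zm] _]] := wole B (ex_intro (fun z => z \in B)
    (val x) Bx).
  exists y; split.
    split=> // w wA.
    rewrite yz.
    by apply: zm; apply/asboolP; exists w.
  move=> w [wA wm].
  apply: val_inj; apply: leanti; last exact: wm.
  by rewrite yz; apply: zm; apply/asboolP; exists w.
- move/countable_injP => [f finj]; apply: na.
  apply/countable_injP; exists (fun b => if insub b is Some v then (f (v :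
    V)).+1 else 0%N).
  have key b : b \in [set b | le b a] -> (insub b : option V) = None -> b = a.
    rewrite inE /= => ba; case: insubP => // /negP nb _.
    apply: contrapT => bna.
    apply: nb.
    by rewrite ba; apply/eqP.
  move=> b c ba ca.
  case Eb : (insub b : option V) => [v|]; case Ec : (insub c : option V) =>
    [w|] //.
    move=> [] /finj vw.
    have {}vw : v = w by apply: vw; rewrite inE.
    move: Eb Ec.
    case: insubP => // v' _ <- [->].
    case: insubP => // w' _ <- [->].
    by rewrite vw.
  by rewrite (key _ ba Eb) (key _ ca Ec).
- move=> [b /andP[ba bna]] /=.
  have /countable_injP[f finj] : countable [set c | le c b].
    apply: contrapT => nb.
    have ab : le a b by apply: amin; exact: asboolT.
    by move/eqP: bna; apply; exact: leanti.
  apply/countable_injP; exists (fun x : V => f (val x)) => x y.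
  rewrite !inE /= => xb yb xy.
  by apply/val_inj/finj; rewrite ?inE.
Qed.

Definition countable_subset (W : Type) : Type := {X : set W | countable X}.

(* Main.v *)
Require Import Defs.
From mathcomp Require Import all_boot all_order all_algebra.
From mathcomp Require Import all_classical all_reals all_analysis.
Local Open Scope classical_set_scope.
From mathcomp Require Import wochoice.

Set Implicit Arguments.
Unset Strict Implicit.
Unset Printing Implicit Defensive.

(** Every ultrafilter Comfort-below v is an iterated limit along v, read off a
    well-founded tree.  So the heart of the matter is a family u of continuum
    many ultrafilters in which no u x is an iterated limit, with mixed labels, of
    the other members.  It is built by a recursion of length continuum on filters
    modulo which most of an independent family of sets stays independent: to
    spoil a tree c against u x, take a fresh independent set, decide its
    membership in the limit of c (countably many decisions about the labels of
    c, each using up finitely many independent sets), and put into u x the set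
    or its complement, whichever contradicts the decision.

    For a countable subset X of omega_1, e X is the sum, along one further member
    of the family, of the tensor products of the u x for x in finite sets L X k
    that increase to X.  Since omega_1 has countable initial segments, the L X k
    can be chosen so that L X k is contained in L Y k for almost all k whenever X
    is contained in Y; then e X is the image of e Y under a projection. *)

(** * Well-orders and cardinality *)

(** The step [G] takes a total function; outside the predecessors of [v] it is filled with [t0],
    which the extensionality hypothesis makes invisible. *)
Lemma wf_recursion (V : Type) (lt : V -> V -> Prop) (T : Type)
    (G : V -> (V -> T) -> T) : inhabited T -> well_founded lt ->
  (forall v f g, (forall w, lt w v -> f w = g w) -> G v f = G v g) ->
  exists f : V -> T, forall v, f v = G v f.
Proof.
move=> [t0] wf Gext.
pose H v (rec : forall w, lt w v -> T) := G v (fun w =>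
  if pselect (lt w v) is left h then rec w h else t0).
exists (Fix wf (fun=> T) H) => v.
rewrite Fix_eq /H; last first.
  move=> x f g fg; congr (G x); apply/funext => w.
  by case: pselect.
by apply: Gext => w wv; case: pselect.
Qed.

Section WellOrder.
Variables (W : eqType) (le : rel W).
Hypothesis wo : well_order le.

Lemma wo_refl : reflexive le.
Proof. by move=> x; apply: (wo_chain_reflexive (withinW wo)). Qed.

Lemma wo_anti : antisymmetric le.
Proof. by move=> x y; apply: (wo_chain_antisymmetric (withinW wo)). Qed.

Lemma wo_total : total le.
Proof. by move=> x y; apply: (wo_chainW (withinW wo)). Qed.

Lemma wo_min (A : set W) : A !=set0 -> exists2 a, A a & forall b, A b -> le a b.
Proof.
move=> [x Ax]; have [|z [[zA zm] _]] := wo (A := fun x => `[< A x >]).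
  by exists x; apply/asboolP.
by exists z => [|b Ab]; [apply/asboolP|apply/zm/asboolP].
Qed.

(** [well_order] only provides least elements of nonempty sets, so transitivity is read off from the
    least of [x], [y] and [z]. *)
Lemma wo_trans : transitive le.
Proof.
move=> y x z xy yz.
have [|m mxyz mm] := @wo_min [set w | [\/ w = x, w = y | w = z]].
  by exists x; constructor 1.
case: mxyz => mE; subst m; first by apply: mm; constructor 3.
  by have -> : x = y; [apply: wo_anti; rewrite xy mm //; constructor 1|].
have zy : le z y by apply: mm; constructor 2.
by have <- : y = z by apply: wo_anti; rewrite yz zy.
Qed.

Lemma wo_wf : well_founded (fun a b => ~~ le b a).
Proof.
move=> a; apply: contrapT => na.
have [|b nb bm] := @wo_min [set b | ~ Acc (fun a b => ~~ le b a) b].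
  by exists a.
apply: nb; constructor => c /negP bc; apply: contrapT => nc.
exact/bc/bm.
Qed.

End WellOrder.

Lemma countable_enum (T : choiceType) (C : set T) :
  countable C -> C !=set0 -> exists e : nat -> T, C `<=` range e.
Proof.
move=> /countable_injP[f finj] [t Ct].
exists (fun n => xget t [set x | C x /\ f x = n]) => x Cx; exists (f x) => //.
case: xgetP => [y _ [Cy fy]|/(_ x)[]//].
by apply: finj; rewrite ?inE.
Qed.

Lemma surj_of_inj (S : choiceType) (T : Type) (f : S -> T) : inhabited S ->
  injective f -> exists g : T -> S, cancel f g.
Proof.
move=> [s0] finj; exists (fun t => xget s0 [set s | f s = t]) => s.
by case: xgetP => [y _ /finj//|/(_ s)[]].
Qed.

Lemma nat_fun_pair : exists (enc : (nat -> nat -> nat) -> nat -> nat)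
  (dec : (nat -> nat) -> nat -> nat -> nat), cancel enc dec.
Proof.
exists (fun z k => if @unpickle (nat * nat)%type k is Some (a, b) then z a b
  else 0), (fun y a b => y (pickle (a, b))) => z.
by apply/funext => a; apply/funext => b; rewrite pickleK.
Qed.

(** A well-order of [nat -> nat] is cut at its first element whose predecessors map onto
    [nat -> nat], or kept whole if there is none. This plays the part of the initial ordinal of the
    continuum. *)
Lemma nat_fun_well_order : exists (V : Type) (lt : V -> V -> Prop)
    (g : V -> (nat -> nat)),
  [/\ well_founded lt, forall a b c, lt a b -> lt b c -> lt a c,
      forall a b, [\/ a = b, lt a b | lt b a],
      forall z, exists v, g v = z
    & forall v (f : V -> (nat -> nat)), exists z, forall a, lt a v -> f a <> z].
Proof.
pose Z : choiceType := nat -> nat.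
have [le wo] := well_ordering_principle Z.
pose lt (a b : Z) := ~~ le b a.
have lttr : transitive lt.
  move=> b a c ab bc; apply/negP => ca.
  have := wo_total wo b c; rewrite (negPf bc) orbF => bc'.
  by move: ab; rewrite /lt (wo_trans wo bc' ca).
have lttot a b : [\/ a = b, lt a b | lt b a].
  rewrite /lt; case: (boolP (le b a)) => ba; last by constructor 2.
  case: (boolP (le a b)) => ab; last by constructor 3.
  by constructor 1; apply: (wo_anti wo); rewrite ab ba.
pose big (a : Z) := exists f : Z -> Z, forall z, exists2 b, lt b a & f b = z.
have small a (f : Z -> Z) : ~ big a -> exists z, forall b, lt b a -> f b <> z.
  move=> na; apply: contrapT => nf; apply: na; exists f => z.
  apply: contrapT => nz; apply: nf; exists z => b ba fb; apply: nz.
  by exists b.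
have [[a0 ba0]|nbig] := pselect (exists a, big a); last first.
  exists Z, lt, id; split; first exact: wo_wf wo.
  - by move=> b a c; apply: lttr.
  - exact: lttot.
  - by move=> z; exists z.
  by move=> v f; apply: small => bv; apply: nbig; exists v.
have [|a [g ga] am] := @wo_min _ _ wo big; first by exists a0.
pose V := {b : Z | lt b a}.
exists V, (fun x y => lt (val x) (val y)), (fun x => g (val x)); split.
- move=> x; have [b xb] : exists b, b = val x by exists (val x).
  elim/(well_founded_ind (wo_wf wo)): b x xb => b IH x xb.
  by constructor => y yx; apply: (IH (val y)); rewrite ?xb.
- by move=> x y z; apply: lttr.
- move=> x y; have [/val_inj|xy|yx] := lttot (val x) (val y);
    by [constructor 1|constructor 2|constructor 3].
- by move=> z; have [b ba gb] := ga z; exists (exist (fun b => lt b a) b ba).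
- move=> [v va] f /=.
  have [|z zP] := @small v (fun b => if insub b is Some x then f (x : V) else id).
    by move=> /am; move: va; rewrite /lt => /negP.
  exists z => -[w wa] /= wv; have := zP w wv.
  by case: insubP => [[w' wa'] _ /= ww'|/negP//]; subst w';
    rewrite (bool_irrelevance wa wa').
Qed.

(* Koenig's argument: nat -> nat is identified with its own power indexed by
   nat, and coordinate n of z is chosen to avoid the n-th members of all C a. *)
Lemma missed_by_countable (V : Type) (D : set V) (C : V -> set (nat -> nat)) :
  (forall f : V -> (nat -> nat), exists z, forall a, D a -> f a <> z) ->
  (forall a, D a -> countable (C a)) ->
  exists z, forall a, D a -> ~ C a z.
Proof.
move=> small cC.
have /choice[e eP] a : exists e : nat -> (nat -> nat), D a -> C a `<=` range e.
  have [[Da C0]|nD] := pselect (D a /\ C a !=set0).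
    by have [e eP] := countable_enum (cC a Da) C0; exists e.
  exists (fun=> id) => Da z Cz; exfalso; apply: nD; split => //.
  by exists z.
have [enc [dec encK]] := nat_fun_pair.
have /choice[z zP] n := small (fun a => dec (e a n) n).
exists (enc z) => a Da /(eP _ Da)[n _ en].
by apply: (zP n a Da); rewrite en encK.
Qed.

(* Fichtenholz-Kantorovich-Hausdorff: f is coded by the pairs (L, m) such that
   the initial segment of f of length m belongs to the finite list L. *)
Lemma independent_family : exists ind : (nat -> nat) -> nat -> bool,
  forall (s : seq (nat -> nat)) (phi : (nat -> nat) -> bool),
    exists n, forall i, i \in s -> ind i n = phi i.
Proof.
exists (fun f n => if @unpickle (seq (seq nat) * nat)%type n is Some (L, m)
  then mkseq f m \in L else false) => s phi.
(* [k] picks a place where two functions differ, and [m] lies beyond these places for all pairs from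
   [s], so initial segments of length [m] tell the members of [s] apart. *)
pose k (p : (nat -> nat) * (nat -> nat)) := xget 0 [set k | p.1 k <> p.2 k].
pose m := (\max_(p <- [seq (f, g) | f <- s, g <- s]) k p).+1.
have sep f g : f \in s -> g \in s -> mkseq f m = mkseq g m -> f = g.
  move=> fs gs fg; apply/funext => j; apply: contrapT => fgj.
  have : f (k (f, g)) <> g (k (f, g)) by rewrite /k; case: xgetP => [//|/(_ j)].
  apply; have km : k (f, g) < m.
    by apply: leq_bigmax_seq => //; apply/allpairsP; exists (f, g).
  by rewrite -(nth_mkseq 0 f km) -(nth_mkseq 0 g km) fg.
exists (pickle ([seq mkseq f m | f <- s & phi f], m)) => f fs.
rewrite pickleK; apply/mapP/idP => [[g]|phif].
  by rewrite mem_filter => /andP[phig gs] /(sep _ _ fs gs) ->.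
by exists f => //; rewrite mem_filter phif.
Qed.

(** * Iterated limits of ultrafilters *)

Lemma countableU T (A B : set T) :
  countable A -> countable B -> countable (A `|` B).
Proof.
by move=> cA cB; rewrite -bigcup2E; apply: bigcup_countable => // -[|[|i]] _ //=.
Qed.

Lemma ultraN T (F : set_system T) (A : set T) :
  UltraFilter F -> F (~` A) <-> ~ F A.
Proof.
move=> FU; have FF := ultra_proper (UltraFilter := FU).
split=> [nA FA|nA]; last by have [//|] := in_ultra_setVsetC A FU.
by apply: (@filter_not_empty _ F); rewrite -(setICr A); apply: filterI.
Qed.

Lemma ultra_of_dichotomy T (F : set_system T) : ProperFilter F ->
  (forall A, F A \/ F (~` A)) -> UltraFilter F.
Proof.
move=> FF dich; split=> // G GF FG; rewrite eqEsubset; split=> // A GA.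
have [//|/FG nA] := dich A; exfalso.
by apply: (@filter_not_empty _ G); rewrite -(setICr A); apply: filterI.
Qed.

Lemma ultra_sub_eq T (F G : set_system T) :
  UltraFilter F -> UltraFilter G -> F `<=` G -> F = G.
Proof.
by move=> [FF Fm] [GF Gm] FG; rewrite (Fm _ GF FG).
Qed.

Inductive tree (Z : Type) := Leaf of nat | Node of Z & (nat -> tree Z).
Arguments Leaf {Z}.

Fixpoint tree_lim (Z : Type) (u : Z -> set_system nat) (c : tree Z) :
    set_system nat :=
  match c with
  | Leaf n => principal_filter n
  | Node z f => [set A | u z [set n | tree_lim u (f n) A]]
  end.

Fixpoint labels (Z : Type) (c : tree Z) : set Z :=
  match c with
  | Leaf _ => set0
  | Node z f => [set z] `|` \bigcup_n labels (f n)
  end.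

Fixpoint tree_bind (Z : Type) (c : tree Z) (g : nat -> tree Z) : tree Z :=
  match c with
  | Leaf n => g n
  | Node z f => Node z (fun n => tree_bind (f n) g)
  end.

Lemma tree_lim_ultra (Z : Type) (u : Z -> set_system nat) c :
  (forall z, UltraFilter (u z)) -> UltraFilter (tree_lim u c).
Proof.
move=> uU; elim: c => [n|z f IH] /=; first exact: principal_filter_ultra.
have uF := ultra_proper (UltraFilter := uU z).
apply: ultra_of_dichotomy => [|A].
  apply: Build_ProperFilter_ex => [A uA|].
    by have [n /= nA] := @filter_ex _ _ uF _ uA; have [FF _] := IH n;
      exact: filter_ex nA.
  split=> [|A B uA uB|A B AB] /=.
  - by apply: (@filterE _ (u z)) => n; have [FF _] := IH n; apply: filterT.
  - by apply: (@filterS2 _ (u z)) uA uB => n; have [FF _] := IH n; apply: filterI.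
  - by apply: (@filterS _ (u z)) => n; have [FF _] := IH n; apply: filterS.
have [|uN] := in_ultra_setVsetC [set n | tree_lim u (f n) A] (uU z); [by left|].
by right; apply: filterS uN => n /= nA; apply/ultraN.
Qed.

(** Grafting trees at the leaves amounts to taking a limit of tree limits; hence tree limits with
    prescribed labels are closed under limits along one another. *)
Lemma tree_lim_bind (Z : Type) (u : Z -> set_system nat) c g :
  tree_lim u (tree_bind c g) =
  [set A | tree_lim u c [set n | tree_lim u (g n) A]].
Proof.
elim: c => [n|z f IH] /=; apply/funext => A.
  by apply/propext; split=> [|/principal_filterP//] gA; apply/principal_filterP.
rewrite /=; congr (u z _).
by apply/funext => n /=; rewrite IH.
Qed.

Lemma labels_bind (Z : Type) (c : tree Z) g :
  labels (tree_bind c g) `<=` labels c `|` \bigcup_n labels (g n).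
Proof.
elim: c => [n|z f IH] /= x; first by move=> gx; right; exists n.
move=> [->|[n _ /IH[fx|gx]]]; [by left; left| |by right].
by left; right; exists n.
Qed.

Section TreeCode.
Let Z := nat -> nat.

Fixpoint probe (c : tree Z) (s : seq nat) : nat + Z :=
  match c with
  | Leaf n => inl n
  | Node z f => if s is i :: s' then probe (f i) s' else inr z
  end.

(* A tree is determined by its labels at all finite sequences, so there are only
   continuum many trees. *)
Lemma probe_inj : injective probe.
Proof.
elim=> [n|z f IH] [n'|z' f'] pp.
- by have [->] : @inl nat Z n = inl n' by exact: (congr1 (@^~ [::]) pp).
- by have : @inl nat Z n = inr z' by exact: (congr1 (@^~ [::]) pp).
- by have : @inr nat Z z = inl n' by exact: (congr1 (@^~ [::]) pp).
- have [->] : @inr nat Z z = inr z' by exact: (congr1 (@^~ [::]) pp).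
  congr Node; apply/funext => i; apply: IH; apply/funext => s.
  exact: (congr1 (@^~ (i :: s)) pp).
Qed.

Lemma tree_surj : exists r : Z -> tree Z, forall c, exists z, r z = c.
Proof.
(* Entry 0 tags the summand; the later entries carry the value. *)
pose code (a : nat + Z) (j : nat) := match a, j with
  | inl n, 0 => 0 | inl n, _.+1 => n | inr z, 0 => 1 | inr z, j.+1 => z j end.
have code_inj : injective code.
  move=> [n|z] [n'|z'] cc.
  - by have /= -> := congr1 (@^~ 1) cc.
  - by have := congr1 (@^~ 0) cc.
  - by have := congr1 (@^~ 0) cc.
  - by congr inr; apply/funext => j; exact: (congr1 (@^~ j.+1) cc).
pose enc (c : tree Z) (k : nat) :=
  if @unpickle (seq nat * nat)%type k is Some (s, j) then code (probe c s) j
  else 0.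
have enc_inj : injective enc.
  move=> c c' cc; apply: probe_inj; apply/funext => s; apply: code_inj.
  apply/funext => j; have := congr1 (@^~ (pickle (s, j))) cc.
  by rewrite /enc pickleK.
have [g encK] := @surj_of_inj {classic (tree Z)} _ enc (inhabits (Leaf 0)) enc_inj.
by exists g => c; exists (enc c); exact: encK.
Qed.

End TreeCode.

(** * A family of ultrafilters separated by trees *)

Section Independence.
Variables (Z I : eqType) (ind : I -> nat -> bool).
Hypothesis ind_free : forall (s : seq I) (phi : I -> bool),
  exists n, forall i, i \in s -> ind i n = phi i.
Implicit Types (F : Z -> set_system nat) (N : set I).

Definition leF F F' := forall z, F z `<=` F' z.

(* N is the set of indices already used up: the family ind restricted to the
   complement of N is independent modulo each filter F z. *)
Definition free_mod F N := (forall z, Filter (F z)) /\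
  forall z B (s : seq I) (phi : I -> bool), F z B -> (forall i, i \in s -> ~ N i) ->
    exists2 n, B n & forall i, i \in s -> ind i n = phi i.

Lemma free_modS F N N' : N `<=` N' -> free_mod F N -> free_mod F N'.
Proof.
move=> NN [FF fr]; split=> // z B s phi FB sN'; apply: (fr z) => // i /sN'.
by move=> nN'i /NN.
Qed.

Lemma free_mod_proper F N z : free_mod F N -> ProperFilter (F z).
Proof.
move=> [FF fr]; apply: Build_ProperFilter_ex => B FB.
by have [n Bn _] := fr z B [::] predT FB (fun _ => ltac:(by [])); exists n.
Qed.

(** Independence concerns one set of the filter and finitely many indices at a time, so it survives
    directed unions. Adding [setT] keeps the union a filter when [P] is empty. *)
Lemma free_mod_bigcup (J : Type) (P : set J) (F : J -> Z -> set_system nat)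
    (N : J -> set I) :
  (forall j, P j -> free_mod (F j) (N j)) ->
  (forall j k, P j -> P k -> exists l, [/\ P l, leF (F j) (F l) & leF (F k) (F l)]) ->
  free_mod (fun z => [set setT] `|` \bigcup_(j in P) F j z)
    (\bigcup_(j in P) N j).
Proof.
move=> fr dir; split=> [z|z B s phi].
  split; first by left.
    move=> A B [->|[j Pj FA]]; first by rewrite setTI.
    move=> [->|[k Pk FB]]; first by rewrite setIT; right; exists j.
    have [l [Pl jl kl]] := dir _ _ Pj Pk; right; exists l => //.
    by have [/(_ z) FF _] := fr l Pl; apply: filterI; [exact: jl|exact: kl].
  move=> A B AB [AT|[j Pj FA]]; first by left; apply/seteqP; split=> // n _;
    apply: AB; rewrite AT.
  by right; exists j => //; have [/(_ z) FF _] := fr j Pj; apply: filterS FA.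
move=> [->|[j Pj FB]] sN.
  by have [n nP] := ind_free s phi; exists n.
have [_ frj] := fr j Pj; apply: (frj z) => // i /sN nN Ni.
by apply: nN; exists j.
Qed.

Definition adjoin F y B : Z -> set_system nat := fun z =>
  if z == y then [set C | exists2 D, F y D & D `&` B `<=` C] else F z.

Lemma adjoin_neq F y B z : z <> y -> adjoin F y B z = F z.
Proof. by move/eqP/negPf => zy; rewrite /adjoin zy. Qed.

Lemma adjoin_mem F N y B : free_mod F N -> adjoin F y B y B.
Proof.
move=> [/(_ y) FF _]; rewrite /adjoin eqxx; exists setT; first exact: filterT.
by move=> n [].
Qed.

Lemma adjoin_le F y B : leF F (adjoin F y B).
Proof.
move=> z C FC; rewrite /adjoin; case: eqP => [zy|//].
by exists C; [rewrite -zy|move=> n []].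
Qed.

Lemma free_mod_adjoin F N y B : free_mod F N ->
  (forall D (s : seq I) (phi : I -> bool), F y D -> (forall i, i \in s -> ~ N i) ->
    exists2 n, (D `&` B) n & forall i, i \in s -> ind i n = phi i) ->
  free_mod (adjoin F y B) N.
Proof.
move=> [FF fr] frB; split=> z; have [->{z}|/negPf zy] := eqVneq z y;
  rewrite /adjoin ?eqxx ?zy //; last exact: fr.
  split; first by exists setT => //; exact: filterT.
    move=> C C' [D FD DC] [D' FD' DC']; exists (D `&` D'); first exact: filterI.
    by move=> n [[Dn D'n] Bn]; split; [apply: DC|apply: DC'].
  by move=> C C' CC' [D FD DC]; exists D => //; apply: subset_trans CC'.
move=> C s phi [D FD DC] sN; have [n DBn nP] := frB D s phi FD sN.
by exists n => //; apply: DC.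
Qed.

(** If adjoining [B] at [y] would destroy independence, some [D] in [F y] and some pattern [phi] on
    a finite [s] are jointly disjoint from [B]. Imposing this pattern at [y] then forces the
    complement of [B] and uses up only [s]. *)
Lemma decide_set F N y B : free_mod F N ->
  exists F' C, [/\ countable C, free_mod F' (N `|` C), leF F F',
    forall z, z <> y -> F' z = F z & F' y B \/ F' y (~` B)].
Proof.
move=> fr; have [frF fr'] := fr.
have [pos|] := pselect (forall D (s : seq I) (phi : I -> bool),
    F y D -> (forall i, i \in s -> ~ N i) ->
    exists2 n, (D `&` B) n & forall i, i \in s -> ind i n = phi i).
  exists (adjoin F y B), set0; split.
  - exact: countable0.
  - by rewrite setU0; apply: free_mod_adjoin.
  - exact: adjoin_le.
  - exact: adjoin_neq.
  - by left; apply: adjoin_mem fr.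
move=> /existsNP[D /existsNP[s /existsNP[phi /not_implyP[FD /not_implyP[sN nex]]]]].
pose E : set nat := [set n | forall i, i \in s -> ind i n = phi i].
exists (adjoin F y E), [set` s]; split.
- exact/finite_set_countable/finite_seq.
- apply: free_mod_adjoin.
    by apply: free_modS fr; apply: subsetUl.
  move=> D' s' phi' FD' s'N.
  have [i|n D'n nP] := fr' y D' (s ++ s') (fun i => if i \in s then phi i else phi' i) FD'.
    rewrite mem_cat => /orP[/sN//|/s'N nNi Ni]; apply: nNi; by left.
  exists n; first split=> // i si.
    by have := nP i; rewrite mem_cat si; apply.
  move=> i s'i; have := nP i; rewrite mem_cat s'i orbT => -> //.
  by case: ifP => // si; case: (s'N i s'i); right.
- exact: adjoin_le.
- exact: adjoin_neq.
- right; rewrite /adjoin eqxx; exists D => // n [Dn En] Bn.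
  by apply: nex; exists n.
Qed.

Lemma leF_refl F : leF F F.
Proof. by move=> z. Qed.

Lemma leF_trans F F' F'' : leF F F' -> leF F' F'' -> leF F F''.
Proof. by move=> FF' F'F'' z B /FF' /F'F''. Qed.

(* Only the filters at labels of c are extended, so a requirement for another
   label can still be imposed freely. *)
Lemma decide_tree c A F N : free_mod F N ->
  exists F' C (b : Prop), [/\ countable C, free_mod F' (N `|` C), leF F F',
    forall z, ~ labels c z -> F' z = F z &
    forall u, (forall z, UltraFilter (u z)) -> leF F' u -> tree_lim u c A <-> b].
Proof.
elim: c F N => [n|y f IH] F N fr.
  exists F, set0, (principal_filter n A); split=> //; last exact: leF_refl.
  by rewrite setU0.
pose St := ((Z -> set_system nat) * set I)%type.
pose good n (S : St) (t : St * Prop) := free_mod S.1 S.2 ->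
  [/\ countable t.1.2, free_mod t.1.1 (S.2 `|` t.1.2), leF S.1 t.1.1,
    forall z, ~ labels (f n) z -> t.1.1 z = S.1 z &
    forall u, (forall z, UltraFilter (u z)) -> leF t.1.1 u ->
      tree_lim u (f n) A <-> t.2].
have /choice[G GP] (nS : nat * St) : exists t, good nS.1 nS.2 t.
  case: nS => n [F1 N1]; have [frS|nfr] := pselect (free_mod F1 N1); last first.
    by exists ((F1, N1), True) => /nfr.
  by have [F' [C [b P]]] := IH n F1 N1 frS; exists ((F', C), b).
(* The subtrees are decided one after another; [st n] is the state just before [f n] is treated. *)
pose st := fix st n : St := if n is k.+1 then
  ((G (k, st k)).1.1, (st k).2 `|` (G (k, st k)).1.2) else (F, N).
have stfr n : free_mod (st n).1 (st n).2.
  by elim: n => [//|n IHn]; have [] := GP (n, st n) IHn.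
have stP n := GP (n, st n) (stfr n).
have stle m n : m <= n -> leF (st m).1 (st n).1.
  elim: n => [|n IHn]; first by rewrite leqn0 => /eqP ->; exact: leF_refl.
  rewrite leq_eqVlt => /orP[/eqP ->|/IHn mn]; first exact: leF_refl.
  by apply: leF_trans mn _; have [] := stP n.
have stF n z : ~ labels (Node y f) z -> (st n).1 z = F z.
  move=> nz; elim: n => [//|n <-]; have [_ _ _ + _] := stP n; apply.
  by move=> lz; apply: nz; right; exists n.
have frU := @free_mod_bigcup nat setT (fun n => (st n).1) (fun n => (st n).2)
  (fun n _ => stfr n).
have {}frU : free_mod (fun z => [set setT] `|` \bigcup_n (st n).1 z)
    (\bigcup_n (st n).2).
  apply: frU => m n _ _; exists (maxn m n); split=> //; apply: stle.
    exact: leq_maxl.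
  exact: leq_maxr.
set FU := (X in free_mod X _) in frU.
pose CU := \bigcup_n (G (n, st n)).1.2.
have NU : \bigcup_n (st n).2 `<=` N `|` CU.
  move=> i [n _]; elim: n => [|n IHn]; first by left.
  by move=> [/IHn//|Gi]; right; exists n.
(* All subtrees now have fixed answers, so one more decision at [y], about the set of positive
   answers, settles the whole tree. *)
have [F' [C [cC frF' leF' F'E F'B]]] :=
  decide_set y [set n | (G (n, st n)).2] (free_modS NU frU).
have stF' n : leF (st n).1 F'.
  by move=> z B FB; apply: leF'; right; exists n.
exists F', (CU `|` C), (F' y [set n | (G (n, st n)).2]); split.
- by apply: countableU => //; apply: bigcup_countable => // n _; have [] := stP n.
- by rewrite setUA.
- exact: (stF' 0).
- move=> z nz; rewrite F'E; last by move=> zy; apply: nz; left.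
  apply/seteqP; split=> B; last by move=> FB; right; exists 0.
  move=> [->|[n _]]; last by rewrite stF.
  by have [/(_ z) FF _] := fr; exact: filterT.
- move=> u uU F'u /=.
  rewrite (_ : [set n | _] = [set n | (G (n, st n)).2]); last first.
    apply/funext => n; apply/propext; have [_ _ _ _] := stP n; apply=> //.
    by apply: leF_trans F'u; exact: (stF' n.+1).
  split; last exact: F'u.
  by case: F'B => // /F'u /ultraN nS /nS.
Qed.

Lemma separate_label c x F N : free_mod F N -> (exists i, ~ N i) ->
  ~ labels c x ->
  exists F' C, [/\ countable C, free_mod F' (N `|` C), leF F F' &
    forall u, (forall z, UltraFilter (u z)) -> leF F' u ->
      tree_lim u c <> u x].
Proof.
move=> fr [i nNi] ncx; pose A := [set n | ind i n].
have [_ frF] := fr.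
(* The index [i] is set aside before [c] is decided. Since [x] is not a label of [c], the filter at
   [x] does not change, and [i] can still be imposed there with either sign. *)
have fri : free_mod F (N `|` [set i]) by apply: free_modS fr; apply: subsetUl.
have [F' [C [b [cC frF' FF' F'E F'b]]]] := decide_tree c A fri.
pose A' := if `[< b >] then ~` A else A.
exists (adjoin F' x A'), ([set i] `|` C); split.
- by apply: countableU => //; exact: countable1.
- rewrite setUA; apply: free_mod_adjoin => // D s phi FD sN.
  have [||n Dn nP] := frF x D (i :: s) (fun j => if j == i then ~~ `[< b >] else phi j).
  + by rewrite -(F'E x ncx).
  + move=> j; rewrite inE => /orP[/eqP -> //|/sN nj Nj]; apply: nj.
    by left; left.
  exists n; last first.
    move=> j sj; rewrite nP ?inE ?sj ?orbT //.
    by case: eqP => // ji; case: (sN j sj); left; right.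
  split=> //; have := nP i; rewrite inE eqxx /A' => /(_ isT).
  by case: `[< b >] => /=; rewrite /A /= => ->.
- by apply: leF_trans FF' _; exact: adjoin_le.
- move=> u uU F'u cu.
  have /F'u : adjoin F' x A' x A' by apply: adjoin_mem frF'.
  rewrite -cu /A'; have cb := F'b u uU (leF_trans (@adjoin_le _ _ _) F'u).
  case: asboolP => hb.
    by move/(ultraN A (tree_lim_ultra c uU)); apply; apply/cb.
  by move/cb.
Qed.

End Independence.

Lemma separated_family : exists u : (nat -> nat) -> set_system nat,
  (forall z, UltraFilter (u z)) /\
  forall c x, ~ labels c x -> tree_lim u c <> u x.
Proof.
pose Z : eqType := nat -> nat.
have [V [lt [g [wf tr tot gsurj small]]]] := nat_fun_well_order.
have [ind ind_free] := independent_family.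
have [r rsurj] := tree_surj.
pose St := ((Z -> set_system nat) * set Z)%type.
pose free (S : St) := free_mod ind S.1 S.2.
(* A requirement, made of a tree [c] and a label [x], is coded by the single tree
   [Node x (fun=> c)]; only the subtree [f 0] is read. *)
pose met (t : tree Z) (S : St) := forall x f, t = Node x f -> ~ labels (f 0) x ->
  forall u, (forall z, UltraFilter (u z)) -> leF S.1 u -> tree_lim u (f 0) <> u x.
have /choice[step stepP] (tS : tree Z * St) : exists S' : St,
    free tS.2 -> (exists i, ~ tS.2.2 i) ->
    [/\ free S', leF tS.2.1 S'.1, countable (S'.2 `\` tS.2.2) & met tS.1 S'].
  case: tS => t [F N] /=.
  have [[fr new]|nP] := pselect (free (F, N) /\ exists i, ~ N i); last first.
    by exists (F, N) => fr new; exfalso; apply: nP.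
  have [[x [f [tE xf]]]|nx] :=
      pselect (exists x f, t = Node x f /\ ~ labels (f 0) x); last first.
    exists (F, N) => _ _; split=> //.
    - exact: leF_refl.
    - by rewrite setDv.
    - by move=> x f tE xf; exfalso; apply: nx; exists x, f.
  have [F' [C [cC frF' FF' sep]]] := separate_label ind_free fr new xf.
  exists (F', N `|` C) => _ _; split=> //.
    apply: sub_countable cC; apply: subset_card_le => i [[//|//]].
  by move=> x' f'; rewrite tE => -[<- <-] _.
pose below v (st : V -> St) : St :=
  (fun z => [set setT] `|` \bigcup_(w in [set w | lt w v]) (st w).1 z,
   \bigcup_(w in [set w | lt w v]) (st w).2).
have [st stE] : exists st : V -> St, forall v, st v = step (r (g v), below v st).
  apply: wf_recursion wf _; first by constructor; exact: (fun=> setT, set0).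
  move=> v f f' ff'; congr (step (_, (_, _))).
    apply/funext => z; congr (_ `|` _).
    by apply: eq_bigcupr => w wv; rewrite ff'.
  by apply: eq_bigcupr => w wv; rewrite ff'.
have stP v : [/\ free (st v), leF (below v st).1 (st v).1,
    countable ((st v).2 `\` (below v st).2) & met (r (g v)) (st v)].
  elim/(well_founded_ind wf): v => v IH; rewrite stE.
  have mono w w' : lt w w' -> lt w' v -> leF (st w).1 (st w').1.
    move=> ww' w'v z B SB; have [_ + _ _] := IH _ w'v; apply.
    by right; exists w.
  apply: stepP.
    apply: free_mod_bigcup => // [w wv|w w' wv w'v]; first by have [] := IH w wv.
    have [->|ww'|w'w] := tot w w'.
    - by exists w'; split=> //; exact: leF_refl.
    - by exists w'; split=> //; [exact: mono|exact: leF_refl].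
    - by exists w; split=> //; [exact: leF_refl|exact: mono].
  (* Each earlier stage uses up only countably many new indices, and the stages before [v] do not
     map onto [nat -> nat], so an index avoids all these increments. *)
  have [|z zP] := missed_by_countable (C := fun w => (st w).2 `\` (below w st).2)
    (small v).
    by move=> w wv; have [] := IH w wv.
  exists z => -[w wv wz].
  (* A used index is new at some stage, so avoiding the increments means avoiding every used
     index. *)
  elim/(well_founded_ind wf): w wv wz => w IHw wv wz.
  apply: (zP w wv); split=> // -[w' w'w w'z].
  by apply: (IHw w') => //; apply: tr w'w wv.
pose F z := [set setT] `|` \bigcup_v (st v).1 z.
have frF : free_mod ind F (\bigcup_v (st v).2).
  apply: free_mod_bigcup => // [v _|v w _ _]; first by have [] := stP v.
  have mono w' v' : lt w' v' -> leF (st w').1 (st v').1.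
    move=> w'v' z B SB; have [_ + _ _] := stP v'; apply.
    by right; exists w'.
  have [->|vw|wv] := tot v w.
  - by exists w; split=> //; exact: leF_refl.
  - by exists w; split=> //; [exact: mono|exact: leF_refl].
  - by exists v; split=> //; [exact: leF_refl|exact: mono].
(* The requirements hold for all ultrafilters above the filters, so any choice of extensions will
   do. *)
have /choice[u uP] z : exists U, UltraFilter U /\ F z `<=` U.
  by have FF := free_mod_proper z frF; exact: ultraFilterLemma.
have uU z : UltraFilter (u z) by case: (uP z).
exists u; split=> // c x ncx.
have [z rz] := rsurj (Node x (fun=> c)); have [v gv] := gsurj z.
have [_ _ _ /(_ x (fun=> c))] := stP v; rewrite gv rz; apply=> // y B SB.
by have [_] := uP y; apply; right; exists v.
Qed.

(** * Finite approximations of countable subsets of omega_1 *)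

Section Omega1.
Variables (W : choiceType) (le : rel W).
Hypothesis hW : is_omega1 le.

Let wo : well_order le. Proof. by case: hW. Qed.
Let seg_countable a : countable [set b | le b a]. Proof. by case: hW. Qed.
Let lt a b := ~~ le b a.

Let ltW a b : lt a b -> le a b.
Proof. by move=> ab; have := wo_total wo a b; rewrite (negPf ab) orbF. Qed.

Lemma omega1_inj (star : nat -> nat) : exists iota : W -> nat -> nat,
  injective iota /\ forall x, iota x <> star.
Proof.
have missed (C : set (nat -> nat)) : countable C -> exists z, ~ C z.
  (* A one-point index set is enough here, as a single value never exhausts [nat -> nat]. *)
  move=> cC; have [|_ _|z zP] := @missed_by_countable unit setT (fun=> C).
  - by move=> f; exists (fun n => (f tt n).+1) => -[] _ /(congr1 (@^~ 0)) /n_Sn.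
  - exact: cC.
  - by exists z; exact: zP tt I.
pose G w (f : W -> nat -> nat) : nat -> nat :=
  xget star [set z | z <> star /\ forall v, lt v w -> f v <> z].
have [iota iotaE] : exists f, forall w, f w = G w f.
  apply: (wf_recursion _ (wo_wf wo)) => [|w f f' ff']; first exact: inhabits star.
  congr xget; apply/funext => z; apply/propext.
  by split=> -[zs fz]; split=> // v vw; have := fz v vw; rewrite ff'.
have iotaP w : iota w <> star /\ forall v, lt v w -> iota v <> iota w.
  rewrite [iota w]iotaE /G; case: xgetP => [z _ //|nz]; exfalso.
  have [|z zP] := missed ([set star] `|` iota @` [set b | le b w]).
    apply: countableU; first exact: countable1.
    by apply: sub_countable (seg_countable w); exact: card_image_le.
  apply: (nz z); split=> [zs|v vw vz]; apply: zP; first by left.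
  by right; exists v => //; exact: ltW.
exists iota; split=> [x y xy|x]; last by case: (iotaP x).
apply: (wo_anti wo); apply/andP; split; apply/negPn/negP => n.
- by case: (iotaP x) => _ /(_ y n); rewrite xy.
- by case: (iotaP y) => _ /(_ x n); rewrite xy.
Qed.

(** By recursion, [F b k] collects [b] and the lists [F a k] for those [a] below [b] among the first
    [k + 1] entries of an enumeration of the segment of [b]; so [F a k] is included as soon as [k]
    reaches the position of [a]. *)
Lemma omega1_finite_approx : exists F : W -> nat -> seq W,
  (forall a k, a \in F a k) /\
  forall a b, le a b -> exists K, forall k, K <= k -> {subset F a k <= F b k}.
Proof.
have /choice[enum enumP] b : exists e : nat -> W, [set a | le a b] `<=` range e.
  apply: countable_enum; first exact: seg_countable.
  by exists b; exact: wo_refl wo b.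
pose G b (F : W -> nat -> seq W) k := b :: flatten
  [seq if lt (enum b i) b then F (enum b i) k else [::] | i <- iota 0 k.+1].
have [F FE] : exists F, forall b, F b = G b F.
  apply: (wf_recursion _ (wo_wf wo)) => [|b f f' ff'].
    exact: inhabits (fun=> [::]).
  apply/funext => k; congr (_ :: flatten _).
  by apply: eq_map => i; case: ifP => // ib; rewrite ff'.
exists F; split=> [a k|a b ab]; first by rewrite FE mem_head.
have [ba|nba] := boolP (le b a).
  have -> : a = b by apply: (wo_anti wo); rewrite ab.
  by exists 0 => k _ x.
have [i _ ia] := enumP b a ab; exists i => k ik x xF.
rewrite FE inE; apply/orP; right; apply/flattenP; exists (F a k) => //.
apply/mapP; exists i; first by rewrite mem_iota.
by rewrite ia /lt nba.
Qed.

(** An unbounded countable set would cover [W] by countably many countable segments. Taking the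
    least bound makes it monotone in [X]. *)
Lemma omega1_bounded (X : set W) : countable X ->
  exists2 d, (forall x, X x -> le x d) &
    forall b, (forall x, X x -> le x b) -> le d b.
Proof.
move=> cX; apply: (@wo_min _ _ wo [set d | forall x, X x -> le x d]).
apply: contrapT => nb; have [_ unc _] := hW; apply: unc.
have -> : [set: W] = \bigcup_(x in X) [set b | le b x].
  apply/seteqP; split=> // b _; apply: contrapT => nbX; apply: nb.
  exists b => x Xx; apply/negPn/negP => /ltW bx; apply: nbX.
  by exists x.
by apply: bigcup_countable.
Qed.

(** [L X k] is the part in [X] of the approximation at the least bound of [X]. Sorting makes an
    eventual inclusion of sets an equality between a filtered list and the smaller list, as needed
    to project coordinates. *)
Lemma omega1_coherent_lists : exists L : countable_subset W -> nat -> seq W,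
  [/\ forall X k, uniq (L X k),
      forall X k x, x \in L X k -> sval X x,
      forall X x, sval X x -> exists K, forall k, K <= k -> x \in L X k
    & forall X Y, sval X `<=` sval Y -> exists K, forall k, K <= k ->
        [seq y <- L Y k | y \in L X k] = L X k].
Proof.
have [F [Fa Fle]] := omega1_finite_approx.
have /choice[d dP] (X : countable_subset W) : exists d,
    (forall x, sval X x -> le x d) /\
    forall b, (forall x, sval X x -> le x b) -> le d b.
  by have [d d1 d2] := omega1_bounded (svalP X); exists d.
pose S (X : countable_subset W) k :=
  [seq y <- undup (F (d X) k) | `[< sval X y >]].
have SE X k x : x \in S X k <-> sval X x /\ x \in F (d X) k.
  rewrite mem_filter mem_undup.
  by split=> [/andP[/asboolP]|[? ?]]; [|apply/andP; split=> //; apply/asboolP].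
have Suniq X k : uniq (S X k) by rewrite filter_uniq // undup_uniq.
exists (fun X k => sort le (S X k)); split.
- by move=> X k; rewrite sort_uniq.
- by move=> X k x; rewrite mem_sort => /SE[].
- move=> X x Xx; have [K KP] := Fle x (d X) ((dP X).1 x Xx).
  by exists K => k Kk; rewrite mem_sort; apply/SE; split=> //; apply: KP.
- move=> X Y XY; have [|K KP] := Fle (d X) (d Y).
    by apply: (dP X).2 => x /XY; exact: (dP Y).1.
  exists K => k Kk; rewrite (filter_sort (wo_total wo) (wo_trans wo)).
  apply/(perm_sortP (wo_total wo) (wo_trans wo) (wo_anti wo)).
  apply: uniq_perm => //; first by rewrite filter_uniq.
  move=> x; rewrite mem_filter mem_sort andbC.
  apply/idP/idP => [/andP[]//|xX]; rewrite xX andbT; apply/SE.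
  by move/SE: xX => [/XY Yx xF]; split=> //; apply: KP.
Qed.

End Omega1.

(** * Sums of tensor products *)

Section TensorProduct.
Variables (Z : eqType) (u : Z -> set_system nat).
Hypothesis uU : forall z, UltraFilter (u z).

(** When [g] has leaves as values, this represents the image of the tensor product of the [u z], for
    [z] in [l], under the map on tuples given by these leaves. *)
Fixpoint tprod (l : seq Z) (g : seq nat -> tree Z) : tree Z :=
  if l is z :: l' then Node z (fun n => tprod l' (fun s => g (n :: s)))
  else g [::].

Lemma labels_tprod l g : (forall s, labels (g s) = set0) ->
  labels (tprod l g) `<=` [set` l].
Proof.
elim: l g => [|z l IH] g g0 /=; first by rewrite g0.
move=> x [->|[n _ lx]]; rewrite /= inE ?eqxx //.
by apply/orP; right; apply: IH lx => s.
Qed.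

Lemma tprod_bind l g h :
  tree_bind (tprod l g) h = tprod l (fun s => tree_bind (g s) h).
Proof.
elim: l g => [//|z l IH] g /=; congr Node; apply/funext => n.
exact: IH.
Qed.

Lemma tree_lim_tprod_mask (m : bitseq) l g : size m = size l ->
  tree_lim u (tprod l (fun s => g (mask m s))) = tree_lim u (tprod (mask m l) g).
Proof.
elim: l m g => [|z l IH] [|b m] g //= [ml]; case: b => /=.
  by apply/funext => A /=; congr (u z _); apply/funext => n /=;
    rewrite (IH m (fun s => g (n :: s))).
rewrite -(IH m g ml); apply/funext => A /=; apply/propext.
have uF := ultra_proper (UltraFilter := uU z).
split=> [uA|gA]; last by apply: (@filterE _ (u z)).
by have [] := @filter_ex _ _ uF _ uA.
Qed.

Variable star : Z.
Hypothesis star_free : forall n, u star <> principal_filter n.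

Lemma free_ultra_tail K : u star [set k | K <= k].
Proof.
have uF := ultra_proper (UltraFilter := uU star).
elim: K => [|K uK]; first by apply: (@filterE _ (u star)).
suff : u star (~` [set K]).
  move=> uK'; apply: (@filterS _ (u star) _ _ _ _ (filterI uK uK')) => k [/= Kk kK].
  by rewrite ltn_neqAle Kk andbT; apply/eqP => KE; apply: kK.
apply/ultraN => uK'; apply: (star_free (n := K)); symmetry.
apply: (ultra_sub_eq _ (uU star)) => [|A].
  exact: principal_filter_ultra.
move=> /principal_filterP AK.
by apply: (@filterS _ (u star) _ _ _ _ uK') => _ ->.
Qed.

(* The ultrafilter on codes of pairs (k, s) whose k-th fiber is the tensor
   product of the u z, for z in l k; the fibers are summed along u star. *)
Definition fibered (l : nat -> seq Z) : tree Z :=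
  Node star (fun k => tprod (l k) (fun s => Leaf (pickle (k, s)))).

(** The map [h] decodes [(k, s)], keeps the coordinates marked by [m k] and applies [phi k]. The
    fibers below [K] are negligible because [u star] is nonprincipal. *)
Lemma fibered_project (l l' : nat -> seq Z) (m : nat -> bitseq)
    (phi : nat -> seq nat -> nat) K :
  (forall k, size (m k) = size (l k)) ->
  (forall k, K <= k -> mask (m k) (l k) = l' k) ->
  exists h : nat -> nat,
    tree_lim u (tree_bind (fibered l) (fun n => Leaf (h n))) =
    tree_lim u (Node star (fun k => tprod (l' k) (fun s => Leaf (phi k s)))).
Proof.
move=> ml ll'; have uF := ultra_proper (UltraFilter := uU star).
pose h n := if @unpickle (nat * seq nat)%type n is Some (k, s)
  then phi k (mask (m k) s) else 0.
exists h; apply/funext => A; apply/propext => /=.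
have E k : K <= k ->
    tree_lim u (tree_bind (tprod (l k) (fun s => Leaf (pickle (k, s))))
      (fun n => Leaf (h n))) A <->
    tree_lim u (tprod (l' k) (fun s => Leaf (phi k s))) A.
  move=> Kk; rewrite -(ll' k Kk) -tree_lim_tprod_mask // tprod_bind /=.
  rewrite (_ : (fun s => Leaf (h (pickle (k, s)))) =
    fun s => Leaf (phi k (mask (m k) s))) //.
  by apply/funext => s; rewrite /h pickleK.
by split=> uA; apply: (@filterS2 _ (u star) _ _ _ _ _ (free_ultra_tail K) uA)
  => k Kk /=; apply E.
Qed.

End TensorProduct.

(** * Subspaces of the space of ultrafilters *)

Import Order.TTheory GRing.Theory Num.Theory.
Import numFieldNormedType.Exports.

Lemma beta_omega_inj (u v : beta_omega) : sval u = sval v -> u = v.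
Proof.
move=> uv; apply/eq_sig_hprop => // ?; exact: Prop_irrelevance.
Qed.

Lemma beta_omega_eq (u v : beta_omega) : sval u `<=` sval v -> u = v.
Proof.
by move=> uv; apply: beta_omega_inj; apply: ultra_sub_eq uv; exact: svalP.
Qed.

Lemma RK_le_image (f : nat -> nat) (u v : beta_omega) :
  sval u = [set A | sval v (f @^-1` A)] -> RK_le u v.
Proof.
move=> uE; pose g (w : beta_omega) : beta_omega :=
  exist _ (f @ sval w) (ultra_fmap f (svalP w)).
exists f, g; split; last by apply: beta_omega_inj; rewrite uE.
split=> [w N /beta_nbhsP[A /= wA AN]|n].
  apply/beta_nbhsP; exists (f @^-1` A) => // w' w'A.
  exact: AN.
apply: beta_omega_eq => A /= /principal_filterP fA.
exact/principal_filterP.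
Qed.

Lemma beta_extension_cvg (K : topologicalType) (f : nat -> K) g :
  is_beta_extension f g -> forall v : beta_omega, f @ sval v --> g v.
Proof.
move=> [gc gE] v N /gc /beta_nbhsP[A vA AN].
case: (svalP v) => vF _; apply: filterS vA => n An /=.
by rewrite -gE; apply: AN; apply/principal_filterP.
Qed.

Section Subspace.
Variables (R : realType) (P : set beta_omega).
Let X : topologicalType := set_type P.

Lemma subspace_nbhsP (w : X) (N : set X) :
  nbhs w N <-> exists2 A, sval (val w) A & [set v : X | sval (val v) A] `<=` N.
Proof.
split=> [|[A wA AN]].
  move=> [_ [[U oU <-] /= Uw UN]].
  have /beta_nbhsP[A wA AU] : nbhs (val w) U by exact: open_nbhs_nbhs.
  by exists A => // v vA; apply/UN/AU.
have : nbhs (val w) [set v : beta_omega | sval v A] by apply/beta_nbhsP; exists A.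
by move/(@initial_continuous _ _ (val : X -> beta_omega) w); apply: filterS AN.
Qed.

(** These indicators of clopen sets separate points from closed sets, and they serve as coordinates
    of the cube containing [stone_cech]. *)
Definition basic_indicator (A : set nat) (w : X) : R :=
  (`[< sval (val w) A >]%:R)%R.

Lemma basic_indicator_continuous A : continuous (basic_indicator A).
Proof.
move=> w N /nbhs_singleton Nw; apply/subspace_nbhsP.
have [wA|wA] := in_ultra_setVsetC A (svalP (val w)).
  by exists A => // v /= vA; move: Nw; rewrite /basic_indicator !asboolT.
exists (~` A) => // v /= vA; move: Nw; rewrite /basic_indicator /=.
have /(ultraN A (svalP (val w))) nw := wA.
have /(ultraN A (svalP (val v))) nv := vA.
by rewrite !asboolF.
Qed.

Lemma basic_indicator_range A : range (basic_indicator A) `<=` `[0%R, 1%R].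
Proof.
move=> _ [w _ <-]; rewrite /basic_indicator /= in_itv /=.
by case: asbool; rewrite ?ler01 ?lexx.
Qed.

Lemma subspace_tychonoff : tychonoff_space X.
Proof.
split.
  move=> x y xy; apply: val_inj; apply: beta_omega_eq => A xA.
  have [//|yA] := in_ultra_setVsetC A (svalP (val y)).
  have nx : nbhs x [set w : X | sval (val w) A] by apply/subspace_nbhsP; exists A.
  have ny : nbhs y [set w : X | sval (val w) (~` A)].
    by apply/subspace_nbhsP; exists (~` A).
  have [w [/= wA /(ultraN A (svalP (val w)))]] := xy _ _ nx ny.
  by move/(_ wA).
move=> a B cB nBa; apply/(@uniform_separatorP _ R).
have /subspace_nbhsP[A aA AB] : nbhs a (~` B).
  by apply: open_nbhs_nbhs; split => //; exact: closed_openC.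
exists (basic_indicator (~` A)); split.
- exact: basic_indicator_continuous.
- exact: basic_indicator_range.
- move=> _ [_ -> <-] /=; rewrite /basic_indicator asboolF //.
  by move/(ultraN A (svalP (val a))).
- move=> _ [b Bb <-] /=; rewrite /basic_indicator asboolT //.
  by apply/(ultraN A (svalP (val b))) => /AB.
Qed.

(** The limit along [v] exists already in [X]; the embedding is continuous and [stone_cech] is
    Hausdorff, so it agrees with the value of the extension at [v]. *)
Lemma subspace_ultra_compact (v : beta_omega) :
  (forall f : nat -> beta_omega, (forall n, P (f n)) ->
    exists2 w, P w & sval w = [set A | sval v [set n | sval (f n) A]]) ->
  ultra_compact R v X.
Proof.
move=> Plim f.
have [g gE] := beta_extension_exists (@stone_cech_embed R X \o f)
  (@stone_cech_hausdorff R X) (@stone_cech_compact R X).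
exists g; split=> //.
have [|w Pw wE] := Plim (fun n => val (f n)).
  by move=> n; exact/set_mem/valP.
pose w' : X := SigSub (mem_set Pw).
exists w' => //.
have [vF _] := svalP v.
have fw : f @ sval v --> w'.
  move=> N /subspace_nbhsP[A /= wA AN]; move: wA; rewrite wE /=.
  by apply: filterS => n; exact: AN.
apply: (@cvg_unique _ (@stone_cech_hausdorff R X)
  ((@stone_cech_embed R X \o f) @ sval v)); last exact: beta_extension_cvg.
exact: cvg_comp fw (stone_cech_embed_continuous (R := R) (x := w')).
Qed.

(** The principal ultrafilters, taken along [v], must converge to some [w] in [X]. Each coordinate
    [basic_indicator A] with [A] in [v] shows that [A] is in [w], so [v] is [w]. *)
Lemma ultra_compact_mem (v : beta_omega) :
  (forall n, P (principal n)) -> ultra_compact R v X -> P v.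
Proof.
move=> Pn Xv; pose f n : X := SigSub (mem_set (Pn n)).
have [g [gE [w _ wE]]] := Xv f.
suff -> : v = val w by exact/set_mem/valP.
apply: beta_omega_eq => A vA.
pose h : unit_map R X := exist _ (basic_indicator A)
  (conj (@basic_indicator_continuous A) (@basic_indicator_range A)).
have [vF _] := svalP v.
have hc : (fun n => basic_indicator A (f n)) @ sval v --> basic_indicator A w.
  have -> : basic_indicator A w = sval (g v) h by rewrite -wE.
  move=> N wN; have gv := beta_extension_cvg gE (v := v).
  have hc : {for g v, continuous (fun z : stone_cech R X => sval z h)}.
    apply: (@continuous_comp (stone_cech R X) {ptws unit_map R X -> R} R sval
      (fun f => f h)); first exact: stone_cech_val_continuous.
    exact: ev_continuous.
  exact: (gv _ (hc N wN)).
have h1 : (fun n => basic_indicator A (f n)) @ sval v --> (1%R : R).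
  move=> N /nbhs_singleton N1; apply: filterS vA => n An /=.
  by rewrite /basic_indicator asboolT //=; exact/principal_filterP.
have : basic_indicator A w = 1%R by exact: (cvg_unique _ hc h1).
rewrite /basic_indicator; case: asboolP => //= _ /eqP.
by rewrite eq_sym oner_eq0.
Qed.

End Subspace.

(** * Comfort predecessors as tree limits, and the embedding *)

Lemma tree_lim_leaf_bind (Z : Type) (u : Z -> set_system nat) c (h : nat -> nat) :
  tree_lim u (tree_bind c (fun n => Leaf (h n))) =
  [set A | tree_lim u c (h @^-1` A)].
Proof.
rewrite tree_lim_bind; apply/funext => A /=; congr (tree_lim u c _).
by apply/funext => n; apply/propext; exact: principal_filterP.
Qed.

Lemma labels_fibered (Z : eqType) (star : Z) l :
  labels (fibered star l) `<=` [set star] `|` \bigcup_k [set` l k].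
Proof.
move=> z /= [->|[k _ lz]]; first by left.
by right; exists k => //; apply: labels_tprod lz.
Qed.

(** The tree limits with labels from [c] form a subspace that contains the principal ultrafilters
    and, by grafting onto [c], all limits along [v] of its sequences. It is [v]-compact, hence
    [w]-compact, hence contains [w]. *)
Lemma Comfort_le_tree (R : realType) (Z : eqType) (u : Z -> set_system nat)
    (v w : beta_omega) c : (forall z, UltraFilter (u z)) ->
  sval v = tree_lim u c -> comfort_le R w v ->
  exists2 c', labels c' `<=` labels c & sval w = tree_lim u c'.
Proof.
move=> uU vE wv.
pose P := [set w : beta_omega |
  exists2 c', labels c' `<=` labels c & sval w = tree_lim u c'].
apply: (@ultra_compact_mem R P w) => [n|]; first by exists (Leaf n).
apply: wv; first exact: subspace_tychonoff R P.
apply: subspace_ultra_compact => f Pf.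
have /choice[d dP] n : exists c', labels c' `<=` labels c /\ sval (f n) = tree_lim u c'.
  by have [c' c'c fc'] := Pf n; exists c'.
have dU : UltraFilter (tree_lim u (tree_bind c d)) by exact: tree_lim_ultra.
exists (exist _ _ dU).
  exists (tree_bind c d) => // z /(@labels_bind _ c d z)[//|[n _ dz]].
  exact: (dP n).1.
rewrite /= tree_lim_bind; apply/funext => A /=; rewrite vE.
by congr (tree_lim u c _); apply/funext => n /=; rewrite (dP n).2.
Qed.

Theorem theorem4 (R : realType) (W : Type) (le : rel W) (hW : is_omega1 le) :
  exists e : countable_subset W -> beta_omega,
    [/\ forall X Y : countable_subset W,
          sval X `<=` sval Y -> RK_le (e X) (e Y),
        forall X Y : countable_subset W,
          comfort_le R (e X) (e Y) -> sval X `<=` sval Y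
      & forall Q : beta_omega -> beta_omega -> Prop,
          (forall u v, RK_le u v -> Q u v) ->
          (forall u v, Q u v -> comfort_le R u v) ->
          injective e /\
          forall X Y : countable_subset W,
            sval X `<=` sval Y <-> Q (e X) (e Y)].
Proof.
have [u [uU usep]] := separated_family.
pose star : nat -> nat := fun=> 0.
have star_free n : u star <> principal_filter n.
  (* A leaf has no labels, so separation makes [u star] nonprincipal. *)
  by move=> /esym; exact: (usep (Leaf n)).
have [iota [iota_inj iota_star]] := @omega1_inj {classic W} le hW star.
have [L [Luniq LX Lmem Lsub]] := @omega1_coherent_lists {classic W} le hW.
pose c X := fibered star (fun k => map iota (L X k)).
pose e (X : countable_subset W) : beta_omega :=
  exist _ (tree_lim u (c X)) (tree_lim_ultra (c X) uU).
have RKe X Y : sval X `<=` sval Y -> RK_le (e X) (e Y).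
  move=> XY; have [K KP] := Lsub X Y XY.
  have [||h hE] := @fibered_project _ u uU star star_free
    (fun k => map iota (L Y k)) (fun k => map iota (L X k))
    (fun k => map (fun y => y \in L X k) (L Y k)) (fun k s => pickle (k, s)) K.
  - by move=> k; rewrite !size_map.
  - by move=> k Kk; rewrite -map_mask -filter_mask KP.
  - by apply: (@RK_le_image h); rewrite -tree_lim_leaf_bind hE.
have Ce X Y : comfort_le R (e X) (e Y) -> sval X `<=` sval Y.
  move=> /(Comfort_le_tree uU (erefl : sval (e Y) = _))[d dY Xd] x Xx.
  apply: contrapT => nYx; have [K KP] := Lmem X x Xx.
  (* Projecting almost all fibers of [e X] to the coordinate [x] yields [u (iota x)]. It thus
     becomes a tree limit whose labels are [star] and values of [iota] on [Y], against
     separation. *)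
  have [||h hE] := @fibered_project _ u uU star star_free
    (fun k => map iota (L X k)) (fun k => [:: iota x])
    (fun k => map (pred1 (x : {classic W})) (L X k)) (fun k s => head 0 s) K.
  - by move=> k; rewrite !size_map.
  - by move=> k Kk; rewrite -map_mask -filter_mask filter_pred1_uniq ?KP.
  apply: (usep (tree_bind d (fun n => Leaf (h n))) (iota x)).
    move=> /(@labels_bind _ _ _ (iota x))[|[n _ //]].
    move=> /dY /(@labels_fibered _ _ _ (iota x)).
    move=> [/iota_star//|[k _ /mapP[y yL /iota_inj xy]]].
    by apply: nYx; rewrite xy; exact: LX yL.
  rewrite tree_lim_leaf_bind -[tree_lim u d]Xd -tree_lim_leaf_bind hE.
  have uF := ultra_proper (UltraFilter := uU star).
  have E A : tree_lim u (Node (iota x) (fun n => Leaf n)) A = u (iota x) A.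
    by congr (u _ _); apply/funext => n; apply/propext; exact: principal_filterP.
  apply/funext => A; apply/propext; rewrite -E.
  split=> /= [uA|uA]; last by apply: (@filterE _ (u star)).
  by have [] := @filter_ex _ _ uF _ uA.
exists e; split=> // Q RKQ QC.
have Qe X Y : sval X `<=` sval Y <-> Q (e X) (e Y).
  by split=> [/RKe/RKQ//|/QC/Ce].
split=> // X Y eXY; apply/eq_sig_hprop => [?|]; first exact: Prop_irrelevance.
by apply/seteqP; split; apply/Qe; rewrite eXY; apply/Qe.
Qed.
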